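(* Let $0<\alpha<1$, $A=-\log(1-\alpha)$ and $b>0$. Let $\{L(t),t\ge 0\}$ be the Logarithmic Lévy process, i.e. the Lévy process with $P(L(1)=k)=\frac{1}{A}\frac{\alpha^{k+1}}{k+1}$, $k=0,1,2,\ldots$, whose Bernstein function is $$\psi_L(\lambda)=\log\left(\frac{Ae^{-\lambda}}{-\log(1-\alpha e^{-\lambda})}\right),\quad\lambda\ge 0,\qquad \psi_L(\infty)=\log\left(\frac{A}{\alpha}\right)>0 .$$ Let $\{T_b(t),t\ge 0\}$ be a Poisson subordinator with Bernstein function $$\psi_T(\lambda)=b(1-e^{-\lambda}),\quad\lambda\ge 0,\qquad\psi_T(\infty)=b>0 .$$ Suppose the processes $L(t)$ and $T_b(t)$ are independent. Then for the subordinated Lévy process $Z(t)=L(T_b(t))$ the following hold. (1) The Bernstein function of $Z(t)$ is $$\psi_Z(\lambda)=b\left(1+\frac{\log(1-\alpha e^{-\lambda})}{Ae^{-\lambda}}\right),\quad\lambda\ge 0,\qquad\psi_Z(\infty)=b\left(1-\frac{\alpha}{A}\right)>0 .$$ (2) The Lévy measure of $Z(t)$ is $$\Pi_Z(n)=\frac{b\,\alpha^{n+1}}{A(n+1)},\qquad n=1,2,\ldots .$$ (3) The transition probability of $Z(t)$ is, for $n=0,1,\ldots$, $$P(Z(t)=n)=e^{-\theta t}\,\frac{\alpha^n}{n!}\sum_{k=0}^{n}\left(\frac{\alpha b t}{A}\right)^{k}B_{n,k}(c_\bullet),\qquad c_k=\frac{k!}{k+1},\quad \theta=b-\frac{\alpha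 b}{A}.$$
   Context: A Lévy process here has stationary independent increments and starts at $0$; a subordinator is a Lévy process with nonnegative increments. The logarithmic series distribution on $\{0,1,2,\ldots\}$ displayed in the claim is known to be infinitely divisible, so the process $L$ exists. The Bernstein function (Laplace exponent) $\psi_V$ of a Lévy process $V$ with values in $[0,\infty)$ is defined by $E[e^{-\lambda V(t)}]=\exp(-t\psi_V(\lambda))$, $\lambda\ge 0$, and $\psi_V(\infty)=\lim_{\lambda\to\infty}\psi_V(\lambda)$. For a Lévy process $V$ with values in $\{0,1,2,\ldots\}$ the Lévy measure is the sequence $\Pi_V(n)\ge 0$, $n=1,2,\ldots$, such that $\psi_V(\lambda)=\sum_{n\ge1}(1-e^{-\lambda n})\Pi_V(n)$ for all $\lambda\ge 0$. Partial Bell polynomials: for a sequence $x_\bullet=(x_1,x_2,\ldots)$ and $1\le k\le n$, $$B_{n,k}(x_\bullet)=\sum \frac{n!\,x_1^{k_1}\cdots x_n^{k_n}}{k_1!(1!)^{k_1}\cdots k_n!(n!)^{k_n}},$$ the sum running over all nonnegative integer solutions $(k_1,\ldots,k_n)$ of $k_1+2k_2+\cdots+nk_n=n$, $k_1+\cdots+k_n=k$. Conventions: $B_{0,0}=1$, and $B_{n,0}=B_{0,k}=0$ for $n,k>0$. *)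

(* Defs.v *)
From HB Require Import structures.
From mathcomp Require Import all_boot all_order all_algebra.
From mathcomp Require Import all_classical all_reals all_analysis.

Set Implicit Arguments.
Unset Strict Implicit.
Unset Printing Implicit Defensive.

Import Order.TTheory GRing.Theory Num.Theory.
Import numFieldNormedType.Exports.

Local Open Scope classical_set_scope.
Local Open Scope ring_scope.

(* Processes are indexed by R, but only the times t >= 0 are ever constrained
   or used. *)

Definition increment (R : realType) (Omega : Type) (X : R -> Omega -> R)
    (s t : R) : Omega -> R :=
  fun w => X t w - X s w.

(* Mutual independence of the increments over consecutive intervals; taking
   some of the B i equal to setT gives the product rule for subfamilies. *)
Definition independent_increments (d : measure_display)
    (Omega : measurableType d) (R : realType) (P : probability Omega R)
    (X : R -> Omega -> R) : Prop :=
  forall (n : nat) (t : nat -> R) (B : nat -> set R),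
    0 <= t 0%N -> (forall i, t i <= t i.+1) -> (forall i, measurable (B i)) ->
    P (\bigcap_(i in [set i | (i < n)%N])
         (increment X (t i) (t i.+1) @^-1` B i)) =
    (\prod_(i < n) P (increment X (t i) (t i.+1) @^-1` B i))%E.

Definition stationary_increments (d : measure_display)
    (Omega : measurableType d) (R : realType) (P : probability Omega R)
    (X : R -> Omega -> R) : Prop :=
  forall (s t : R) (B : set R), 0 <= s -> 0 <= t -> measurable B ->
    P (increment X s (s + t) @^-1` B) = P (increment X 0 t @^-1` B).

(* No path regularity is required. *)
Definition levy_process (d : measure_display)
    (Omega : measurableType d) (R : realType) (P : probability Omega R)
    (X : R -> Omega -> R) : Prop :=
  [/\ forall t, 0 <= t -> measurable_fun [set: Omega] (X t),
      {ae P, forall w, X 0 w = 0},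
      independent_increments P X
    & stationary_increments P X].

Definition subordinator (d : measure_display)
    (Omega : measurableType d) (R : realType) (P : probability Omega R)
    (X : R -> Omega -> R) : Prop :=
  levy_process P X /\
  forall s t : R, 0 <= s -> s <= t -> {ae P, forall w, X s w <= X t w}.

(* A process with values in {0, 1, 2, ...} seen as a real-valued one. *)
Definition real_process (R : realType) (Omega : Type) (N : R -> Omega -> nat) :
    R -> Omega -> R :=
  fun t w => (N t w)%:R.

Definition poisson_subordinator (d : measure_display)
    (Omega : measurableType d) (R : realType) (P : probability Omega R)
    (N : R -> Omega -> nat) : Prop :=
  subordinator P (real_process N) /\
  exists2 r : R, 0 < r &
    forall (t : R) (k : nat), 0 <= t ->
      P [set w | N t w = k] = (expR (- (r * t)) * (r * t) ^+ k / k`!%:R)%:E.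

Definition process_sigma_algebra (R : realType) (Omega : Type)
    (X : R -> Omega -> R) : set (set Omega) :=
  <<s \bigcup_(t in [set t : R | 0 <= t])
        preimage_set_system [set: Omega] (X t) measurable >>.

Definition independent_processes (d : measure_display)
    (Omega : measurableType d) (R : realType) (P : probability Omega R)
    (X Y : R -> Omega -> R) : Prop :=
  forall E F : set Omega,
    process_sigma_algebra X E -> process_sigma_algebra Y F ->
    P (E `&` F) = (P E * P F)%E.

Definition bernstein_function (d : measure_display)
    (Omega : measurableType d) (R : realType) (P : probability Omega R)
    (V : R -> Omega -> R) (psi : R -> R) : Prop :=
  forall t lambda : R, 0 <= t -> 0 <= lambda ->
    ('E_P[fun w => expR (- (lambda * V t w))])%E =
    (expR (- (t * psi lambda)))%:E.

(* The value Pi 0 is irrelevant. *)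
Definition levy_measure (d : measure_display)
    (Omega : measurableType d) (R : realType) (P : probability Omega R)
    (V : R -> Omega -> nat) (Pi : nat -> R) : Prop :=
  (forall n, (1 <= n)%N -> 0 <= Pi n) /\
  exists2 psi : R -> R, bernstein_function P (real_process V) psi &
    forall lambda : R, 0 <= lambda ->
      (\sum_(1 <= n < N) (1 - expR (- (lambda * n%:R))) * Pi n)
        @[N --> \oo] --> psi lambda.

(* The index i : 'I_n stands for i + 1 in {1, ..., n}, so k i is the exponent
   of x i.+1; each exponent of a solution is at most n.  The sum gives
   B_(0,0) = 1 and B_(n,0) = B_(0,k) = 0 for n, k > 0. *)
Definition partial_bell (R : realType) (n k : nat) (x : nat -> R) : R :=
  \sum_(m : {ffun 'I_n -> 'I_n.+1} |
      (\sum_(i < n) i.+1 * m i == n)%N && (\sum_(i < n) m i == k)%N)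
    (n`!%:R * \prod_(i < n) x i.+1 ^+ m i)
      / \prod_(i < n) ((m i)`!%:R * (i.+1)`!%:R ^+ m i).

(* Main.v *)
(* Since L is valued in the naturals, t |-> E[exp(-lambda L(t))] is multiplicative
   and bounded by 1, hence equal to p ^ t where p is its value at t = 1, which the
   logarithmic series computes.  Conditioning on the countably many values of the
   increments of T turns the increments of Z into increments of L between
   deterministic times, so that the increments of Z are independent and stationary
   and E[exp(-lambda Z(t))] = \sum_m P(T(t) = m) p ^ m = exp(-b t (1 - p)).
   Likewise P(Z(t) = n) = \sum_m P(T(t) = m) [s^n] f(s)^m, f being the generating
   function of L(1).  Splitting off f(0) = alpha / A and summing the Poisson weights
   leaves exp(- b t (1 - f(0))) \sum_k (b t)^k / k! [s^n] (f(s) - f(0))^k, and these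
   coefficients are partial Bell polynomials. *)

Require Import Defs.
From HB Require Import structures.
From mathcomp Require Import all_boot all_order all_algebra.
From mathcomp Require Import all_classical all_reals all_analysis.
From mathcomp Require Import measurable_realfun ring lra.

Set Implicit Arguments.
Unset Strict Implicit.
Unset Printing Implicit Defensive.

Import Order.TTheory GRing.Theory Num.Theory.
Import numFieldNormedType.Exports.

Local Open Scope classical_set_scope.
Local Open Scope ring_scope.

(** * Real analysis *)

Lemma is_derive_log_partial_sum (R : realType) (N : nat) (y : R) :
  is_derive y 1 (fun x : R => \sum_(0 <= k < N) x ^+ k.+1 / k.+1%:R)
    (\sum_(0 <= k < N) y ^+ k).
Proof.
elim: N => [|N IH].
  rewrite big_nil (_ : (fun _ => _) = cst 0); first exact: is_derive_cst.
  by apply/funext => x; rewrite big_nil.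
rewrite big_nat_recr//=.
rewrite (_ : (fun _ => _) = (fun x : R => \sum_(0 <= k < N) x ^+ k.+1 / k.+1%:R)
    + (N.+1%:R)^-1 \*: (fun x => x ^+ N.+1)); last first.
  by apply/funext => x; rewrite big_nat_recr//= fctE mulrC.
apply: is_deriveD.
have h : is_derive y 1 (fun x : R => x ^+ N.+1) (N.+1%:R * y ^+ N).
  have := @is_deriveX R R id N.+1 y 1 1 (is_derive_id _ _).
  rewrite /GRing.scale /= mulr1 (_ : id ^+ N.+1 = (fun x : R => x ^+ N.+1)) //.
  by apply/funext => x; rewrite exprfctE.
have := @is_deriveZ R R R _ (N.+1%:R^-1) y 1 _ h.
by rewrite /GRing.scale /= mulrA mulVf ?mul1r.
Qed.

(** The remainder vanishes at 0 and, by the geometric sum, has derivative y^N / (1 - y); the mean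
    value theorem on [0, x] then bounds it. *)
Lemma log_remainder_bound (R : realType) (x : R) (N : nat) : 0 <= x < 1 ->
  `|- ln (1 - x) - \sum_(0 <= k < N) x ^+ k.+1 / k.+1%:R| <= x ^+ N / (1 - x).
Proof.
move=> /andP[x0 x1].
pose f := (fun y : R => - ln (1 - y))
  - (fun y => \sum_(0 <= k < N) y ^+ k.+1 / k.+1%:R).
have df (y : R) : y < 1 -> is_derive y 1 f (y ^+ N / (1 - y)).
  move=> y1.
  have -> : y ^+ N / (1 - y) = (1 - y)^-1 - \sum_(0 <= k < N) y ^+ k.
    have := subrX1 y N; rewrite -(big_mkord predT (fun i => y ^+ i)) => h.
    have y1' : 1 - y != 0 by rewrite subr_eq0 eq_sym lt_eqF.
    apply: (mulIf y1'); rewrite mulfVK// mulrBl mulVf//.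
    by rewrite -[1 - y]opprB mulrN [_ * (y - 1)]mulrC -h opprK addrC subrK.
  apply: is_deriveB; last exact: is_derive_log_partial_sum.
  have -> : (1 - y)^-1 = - ((1 - y)^-1 * -1) by rewrite mulrN1 opprK.
  apply: is_deriveN.
  have hg : is_derive y 1 (fun z : R => 1 - z) (-1).
    have := @is_deriveB R R R (cst 1) id y 1 0 1 (is_derive_cst _ _ _) (is_derive_id _ _).
    by rewrite sub0r.
  have hl : is_derive (1 - y) 1 (@ln R) (1 - y)^-1.
    by apply: is_derive1_ln; rewrite subr_gt0.
  exact: (@is_derive1_comp R (@ln R) _ y _ _ hl hg).
have [||c] := @MVT_segment R f (fun y => y ^+ N / (1 - y)) 0 x x0.
- by move=> y; rewrite in_itv/= => /andP[_ yx]; apply: df; exact: lt_trans yx x1.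
- apply: continuous_in_subspaceT => y; rewrite inE/= in_itv/= => /andP[_ yx].
  apply: differentiable_continuous; apply/derivable1_diffP.
  by have [] := df y (le_lt_trans yx x1).
rewrite in_itv/= => /andP[c0 cx].
have -> : f 0 = 0.
  rewrite /f fctE subr0 ln1 oppr0 sub0r big1 ?oppr0// => i _.
  by rewrite expr0n mul0r.
rewrite !subr0 {1}/f fctE => ->.
have c1 := le_lt_trans cx x1.
rewrite !ger0_norm//; last first.
  by rewrite mulr_ge0// mulr_ge0 ?exprn_ge0// invr_ge0 subr_ge0 ltW.
(* The interval length [x] is at most 1, and y^N / (1 - y) is nondecreasing, so its value at [c] is
   at most its value at [x]. *)
rewrite -[leRHS]mulr1; apply: ler_pM => //; last exact: ltW.
  by rewrite mulr_ge0 ?exprn_ge0// invr_ge0 subr_ge0 ltW.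
apply: ler_pM; rewrite ?exprn_ge0//.
- by rewrite invr_ge0 subr_ge0 ltW.
- by rewrite lerXn2r// ?nnegrE.
- by rewrite lef_pV2 ?posrE ?subr_gt0// lerB.
Qed.

Lemma cvg_log_series (R : realType) (x : R) : 0 <= x < 1 ->
  (\sum_(0 <= k < N) x ^+ k.+1 / k.+1%:R) @[N --> \oo] --> - ln (1 - x).
Proof.
move=> x01; have /andP[x0 x1] := x01.
apply/cvgrPdist_le => e e0.
have h : (x ^+ N / (1 - x)) @[N --> \oo] --> (0 : R).
  rewrite -[X in _ --> X](mul0r ((1 - x)^-1)).
  by apply: cvgMl; apply: cvg_expr; rewrite ger0_norm.
move/cvgrPdist_le : h => /(_ _ e0); apply: filterS => N.
rewrite /= sub0r normrN => h; apply: le_trans h.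
by apply: le_trans (log_remainder_bound N x01) _; exact: ler_norm.
Qed.

(** Limits are computed with real arithmetic, whereas probabilities and expectations arrive as
    extended-real series; this is the bridge. *)
Lemma cvg_nneseries (R : realType) (u : nat -> R) (l : R) :
  (\sum_(0 <= k < N) u k) @[N --> \oo] --> l ->
  (\sum_(k <oo) (u k)%:E)%E = l%:E.
Proof.
move=> h; apply/cvg_lim => //.
rewrite (_ : (fun _ => _) = (fun N => (\sum_(0 <= k < N) u k)%:E)).
  by apply: cvg_EFin => //; near=> n.
by apply/funext => N; rewrite sumEFin.
Unshelve. all: end_near. Qed.

(** Both bounds come from ln (1 + y) <= y, taken at y = - u and at y = u / (1 - u). They squeeze the
    quotient to 1 as u tends to 0, which yields the values of the Bernstein functions at
    infinity. *)
Lemma ln1B_bounds (R : realType) (u : R) : 0 < u < 1 ->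
  1 - u <= u / (- ln (1 - u)) <= 1.
Proof.
move=> /andP[u0 u1].
have hl : u <= - ln (1 - u).
  by rewrite lerNr; apply: le_ln1Dx; rewrite ltrN2.
have lp := lt_le_trans u0 hl.
have hr : - ln (1 - u) <= u / (1 - u).
  rewrite -lnV ?posrE ?subr_gt0//.
  rewrite [X in ln X](_ : _ = 1 + u / (1 - u)); last first.
    by field; rewrite subr_eq0 eq_sym lt_eqF.
  apply: (@le_ln1Dx _ (u / (1 - u))); apply: (@lt_le_trans _ _ 0); first by rewrite ltrN10.
  by rewrite divr_ge0// ?subr_ge0 ltW.
apply/andP; split; last by rewrite ler_pdivrMr// mul1r.
rewrite ler_pdivlMr// mulrC -ler_pdivlMr ?subr_gt0//.
Qed.

(* phi is nonincreasing, so phi t ^+ n = phi (n t) lies between the values of phi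
   at the integers surrounding n t; taking n large determines phi t. *)
Lemma multiplicative_expR (R : realType) (phi : R -> R) :
  (forall s t, 0 <= s -> 0 <= t -> phi (s + t) = phi s * phi t) ->
  (forall t, 0 <= t -> 0 <= phi t <= 1) -> 0 < phi 1 ->
  forall t, 0 <= t -> phi t = expR (t * ln (phi 1)).
Proof.
move=> hM h01 h1 t t0.
have phi0 : phi 0 = 1.
  by apply: (mulfI (lt0r_neq0 h1)); rewrite -hM// addr0 mulr1.
have hX n s : 0 <= s -> phi (n%:R * s) = phi s ^+ n.
  move=> s0; elim: n => [|n IH]; first by rewrite mul0r phi0.
  by rewrite -natr1 mulrDl mul1r hM ?mulr_ge0// IH exprSr.
have hle s u : 0 <= s -> s <= u -> phi u <= phi s.
  move=> s0 su; have u0 : 0 <= u - s by rewrite subr_ge0.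
  rewrite -(subrK s u) addrC hM// ler_piMr//; first by case/andP: (h01 _ s0).
  by case/andP: (h01 _ u0).
set a := - ln (phi 1).
have a0 : 0 <= a by rewrite oppr_ge0 ln_le0//; case/andP: (h01 1 ler01).
have phin n : phi n%:R = expR (- (n%:R * a)).
  by rewrite -[n%:R]mulr1 hX// mulr1 -mulrN opprK expRM_natl lnK.
have tn n : expR (- ((n%:R * t + 1) * a)) <= phi t ^+ n
            <= expR (- ((n%:R * t - 1) * a)).
  have nt0 : 0 <= n%:R * t by rewrite mulr_ge0.
  have /andP[k1 k2] := truncn_itv nt0; set k := Num.truncn _ in k1 k2.
  rewrite -hX//; apply/andP; split.
    apply: (@le_trans _ _ (phi k.+1%:R)); last by apply: hle => //; exact: ltW.
    by rewrite phin ler_expR lerN2 ler_wpM2r// -natr1 lerD2r.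
  apply: (@le_trans _ _ (phi k%:R)); first exact: hle.
  by rewrite phin ler_expR lerN2 ler_wpM2r// lerBlDr natr1 ltW.
have pt0 : 0 < phi t.
  by have /andP[h _] := tn 1%N; apply: lt_le_trans h; exact: expR_gt0.
suff : ln (phi t) = - (t * a) by rewrite mulrN opprK => <-; rewrite lnK.
apply/eqP; rewrite -subr_eq0 opprK -normr_le0.
apply/ler_addgt0Pl => e e0; rewrite addr0.
(* Taking logarithms in [tn] bounds |ln (phi t) + t a| by a / n, so any n with a <= n e suffices. *)
pose n := (Num.truncn (a / e)).+1.
have n0 : 0 < n%:R :> R by rewrite ltr0n.
have ne : a <= n%:R * e.
  rewrite -ler_pdivrMr//; apply: ltW.
  have /truncn_itv/andP[] : 0 <= a / e by rewrite divr_ge0// ltW.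
  by [].
have /andP[l r] := tn n.
have pn : 0 < phi t ^+ n by rewrite exprn_gt0.
rewrite -ler_ln ?posrE ?expR_gt0// expRK lnXn// -mulr_natl in l.
rewrite -ler_ln ?posrE ?expR_gt0// expRK lnXn// -mulr_natl in r.
rewrite ler_norml; apply/andP; split; rewrite -(ler_pM2l n0); lra.
Qed.

(** * Partial Bell polynomials and compound Poisson coefficients *)

(* Modulo 'X^n.+1 the product of the truncated exponentials of y i * 'X is the
   exponential of (\sum_i y i) * 'X. *)
Lemma coef_prod_trunc_exp (R : numFieldType) (S : comAlgType R) (n N : nat)
    (y : 'I_N -> S) (k : nat) : (k <= n)%N ->
  (\prod_(i < N) \poly_(j < n.+1) ((j`!%:R : R)^-1 *: y i ^+ j))`_k =
  (k`!%:R : R)^-1 *: (\sum_(i < N) y i) ^+ k.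
Proof.
elim/big_rec2 : _ k => [|i s p _ IH] k kn.
  by rewrite coef1 expr0n; case: k kn => [|k] _; rewrite ?fact0 ?invr1 ?scale1r ?scaler0.
rewrite coefM addrC exprDn scaler_sumr; apply: eq_bigr => j _.
have jk : (j <= k)%N by rewrite -ltnS.
have jn := leq_trans jk kn.
rewrite coef_poly ltnS jn IH; last exact: leq_trans (leq_subr _ _) kn.
rewrite -scalerAl -scalerAr scalerA [y i ^+ j * _]mulrC -(@scaler_nat R _ _ (_ * _)) [RHS]scalerA.
congr (_ *: _).
have f0 (m : nat) : m`!%:R != 0 :> R by rewrite pnatr_eq0 -lt0n fact_gt0.
apply: (mulIf (f0 k)); rewrite -{1}(bin_fact jk) !natrM.
field.
by rewrite !f0.
Qed.

(* Expanding the product of truncated exponentials in {poly {poly R}} yields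
   exactly the sum over {ffun 'I_n -> 'I_n.+1} that defines partial_bell. *)
Lemma coef_expr_partial_bell (R : realType) (x : nat -> R) (n k : nat) :
  (k <= n)%N ->
  ((\sum_(i < n) (x i.+1 / i.+1`!%:R) *: 'X^(i.+1)) ^+ k)`_n =
  k`!%:R / n`!%:R * partial_bell n k x.
Proof.
move=> kn.
pose a i : R := x i.+1 / i.+1`!%:R.
pose y (i : 'I_n) : {poly R} := a i *: 'X^(i.+1).
have f0 (m : nat) : m`!%:R != 0 :> R by rewrite pnatr_eq0 -lt0n fact_gt0.
(* The algebra is {poly R} itself: the outer indeterminate records the sum of the exponents [m i],
   the inner one their weighted sum. *)
have := @coef_prod_trunc_exp R _ n n y k kn.
move/(congr1 (fun p : {poly R} => k`!%:R * p`_n)).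
rewrite coefZ mulrA divff// mul1r => <-.
under eq_bigr do rewrite poly_def.
rewrite bigA_distr_bigA /= coef_sum coef_sum /partial_bell.
rewrite -mulrA; congr (_ * _).
rewrite mulr_sumr [RHS]big_mkcond /=.
apply: eq_bigr => m _.
under eq_bigr => i _ do rewrite /y exprZn -exprM scalerA.
have -> : \prod_(i < n) ((((m i)`!%:R)^-1 * a i ^+ m i) *: 'X^(i.+1 * m i) *: 'X^(m i))
  = (\prod_(i < n) (((m i)`!%:R)^-1 * a i ^+ m i)) *: 'X^(\sum_(i < n) i.+1 * m i)
      *: 'X^(\sum_(i < n) m i) :> {poly {poly R}}.
  under eq_bigr => i _ do rewrite -mul_polyC -[_ *: 'X^(i.+1 * _)]mul_polyC.
  by rewrite big_split /= -rmorph_prod big_split /= -rmorph_prod !expr_sum !mul_polyC.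
(* Extracting the outer coefficient [k] and the inner coefficient [n] reproduces the two constraints
   of [partial_bell]. *)
rewrite coefZ coefXn eq_sym; case: ifPn => [/andP[/eqP hn /eqP ->]|].
  rewrite eqxx mulr1 coefZ coefXn hn eqxx mulr1.
  rewrite -(mulrA n`!%:R) mulKf//.
  rewrite -prodf_div; apply: eq_bigr => i _.
  rewrite /a expr_div_n; field.
  by rewrite f0 expf_neq0.
rewrite negb_and; case: (_ =P k) => /=; last by rewrite mulr0 coef0.
by rewrite orbF mulr1 coefZ coefXn eq_sym => _ /negPf ->; rewrite mulr0.
Qed.
Lemma big_ord_eq0_le (R : nmodType) (f : nat -> R) (a b : nat) :
  (a <= b)%N -> (forall k, (a <= k)%N -> f k = 0) ->
  \sum_(k < a) f k = \sum_(k < b) f k.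
Proof.
move=> ab f0; rewrite -(big_mkord predT f) -[RHS](big_mkord predT f).
rewrite (@big_cat_nat _ _ _ a 0 b)//= [X in _ = _ + X]big_nat_cond [X in _ = _ + X]big1 ?addr0//.
by move=> k /andP[/andP[ak _] _]; exact: f0.
Qed.

(** Binomial expansion around the constant term: the rest is divisible by 'X, so its powers beyond
    [n] do not reach degree [n]. The range of [k] is thus the same for all [m], which later allows
    summing over [m] first. *)
Lemma coef_trunc_expr (R : comNzRingType) (p : nat -> R) (n m : nat) :
  ((\poly_(k < n.+1) p k) ^+ m)`_n =
  \sum_(k < n.+1) 'C(m, k)%:R * p 0%N ^+ (m - k) *
    ((\sum_(i < n) p i.+1 *: 'X^(i.+1)) ^+ k)`_n.
Proof.
set q := \sum_(i < n) _.
have q0 k : (n < k)%N -> (q ^+ k)`_n = 0.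
  move=> nk; rewrite (_ : q = 'X * \sum_(i < n) p i.+1 *: 'X^i); last first.
    by rewrite mulr_sumr; apply: eq_bigr => i _; rewrite exprS scalerAr.
  by rewrite exprMn coefXnM nk.
rewrite poly_def big_ord_recl expr0 alg_polyC -/q exprDn coef_sum.
pose f k := 'C(m, k)%:R * p 0%N ^+ (m - k) * (q ^+ k)`_n.
transitivity (\sum_(k < m.+1) f k).
  by apply: eq_bigr => k _; rewrite coefMn -rmorphXn coefCM -mulr_natl mulrA.
(* Both ranges are extended to a common one: the added terms vanish by the binomial coefficient on
   one side and by [q0] on the other. *)
rewrite (@big_ord_eq0_le _ f m.+1 (m.+1 + n.+1)) ?leq_addr//.
  by rewrite -(@big_ord_eq0_le _ f n.+1 (m.+1 + n.+1)) ?leq_addl// => k nk;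
    rewrite /f q0 ?mulr0.
by move=> k mk; rewrite /f bin_small// !mul0r.
Qed.

(** The terms with m < k vanish, and C(m, k) / m! = 1 / (k! (m - k)!), so shifting the index by [k]
    leaves the exponential series at c z. *)
Lemma cvg_shifted_exp_series (R : realType) (c z : R) (k : nat) :
  (\sum_(0 <= m < M) c ^+ m / m`!%:R * ('C(m, k)%:R * z ^+ (m - k)))
    @[M --> \oo] --> c ^+ k / k`!%:R * expR (c * z).
Proof.
rewrite -(cvg_shiftn k).
have f0 (m : nat) : m`!%:R != 0 :> R by rewrite pnatr_eq0 -lt0n fact_gt0.
rewrite (_ : (fun _ => _) = (fun M => c ^+ k / k`!%:R *
    \sum_(0 <= m < M) (c * z) ^+ m / m`!%:R)).
  by apply: cvgMr; exact: is_cvg_series_exp_coeff.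
apply/funext => M; rewrite (@big_cat_nat _ _ _ k) ?leq_addl//= big_nat_cond big1 ?add0r.
  rewrite -{1}[k]add0n big_addn addnK mulr_sumr; apply: eq_bigr => m _.
  rewrite addnK exprD exprMn.
  have /(congr1 (fun n => n%:R : R)) := bin_fact (leq_addl m k).
  rewrite addnK !natrM => e.
  have h : 'C(m + k, k)%:R / (m + k)`!%:R = (k`!%:R * m`!%:R)^-1 :> R.
    by rewrite -e; field; rewrite !f0 pnatr_eq0 -lt0n bin_gt0 leq_addl.
  transitivity (c ^+ m * c ^+ k * z ^+ m * ('C(m + k, k)%:R / (m + k)`!%:R)).
    by ring.
  by rewrite h; field; rewrite !f0.
by move=> m /andP[/andP[_ mk] _]; rewrite bin_small// mul0r mulr0.
Qed.

(** By [coef_trunc_expr] the partial sums are a finite combination, over [k], of the series of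
    [cvg_shifted_exp_series] at z = p 0; the common factor exp (c p 0) merges with exp (- c). *)
Lemma cvg_compound_poisson (R : realType) (p : nat -> R) (c : R) (n : nat) :
  (\sum_(0 <= m < M) expR (- c) * c ^+ m / m`!%:R *
     ((\poly_(k < n.+1) p k) ^+ m)`_n) @[M --> \oo] -->
  expR (- (c * (1 - p 0%N))) *
    \sum_(k < n.+1) c ^+ k / k`!%:R *
      ((\sum_(i < n) p i.+1 *: 'X^(i.+1)) ^+ k)`_n.
Proof.
set a := fun k => ((\sum_(i < n) p i.+1 *: 'X^(i.+1)) ^+ k)`_n.
rewrite (_ : (fun _ => _) = (fun M => expR (- c) * \sum_(k < n.+1) a k *
    \sum_(0 <= m < M) c ^+ m / m`!%:R * ('C(m, k)%:R * p 0%N ^+ (m - k)))).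
  rewrite (_ : _ * _ = expR (- c) * \sum_(k < n.+1) a k *
      (c ^+ k / k`!%:R * expR (c * p 0%N))).
    apply: cvgMr; apply: cvg_big => [|k _]; first exact: add_continuous.
    apply: cvgMr.
    exact: cvg_shifted_exp_series.
  rewrite mulrBr mulr1 opprB addrC expRD -mulrA; congr (_ * _).
  rewrite mulr_sumr; apply: eq_bigr => k _; rewrite /a; ring.
apply/funext => M; rewrite mulr_sumr.
under [RHS]eq_bigr => k _ do rewrite mulr_sumr mulr_sumr.
rewrite [RHS]exchange_big /=; apply: eq_bigr => m _.
rewrite coef_trunc_expr mulr_sumr; apply: eq_bigr => k _; rewrite /a; ring.
Qed.

(** Every monomial of the polynomial has degree [k] and weight [n], so it picks up exactly u^k
    v^n. *)
Lemma partial_bell_scale (R : realType) (n k : nat) (u v : R) (y : nat -> R) :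
  partial_bell n k (fun j => u * v ^+ j * y j) =
  u ^+ k * v ^+ n * partial_bell n k y.
Proof.
rewrite /partial_bell mulr_sumr; apply: eq_bigr => m /andP[/eqP mn /eqP mk].
under eq_bigr => i _ do rewrite !exprMn -exprM.
rewrite !big_split /= -!expr_sum mn mk; ring.
Qed.

(** * Levy processes valued in the naturals *)

Section almost_sure_partition.
Variables (d : measure_display) (Omega : measurableType d) (R : realType).
Variable P : probability Omega R.

Lemma probability_setI1 (E G : set Omega) : measurable E -> measurable G ->
  P G = 1%E -> P (E `&` G) = P E.
Proof.
move=> mE mG PG; rewrite [in RHS](_ : E = (E `&` G) `|` (E `&` ~` G)); last first.
  by rewrite -setIUr setUv setIT.
rewrite measureU //; last 3 first.
- exact: measurableI.
- by apply: measurableI => //; exact: measurableC.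
- by rewrite setIACA setIid setICr setI0.
rewrite [X in (_ + X)%E](_ : _ = 0%E) ?adde0//; apply/eqP.
rewrite -measure_le0; apply: (@le_trans _ _ (P (~` G))).
  by apply: le_measure; rewrite ?inE//; [apply: measurableI => //|]; exact: measurableC.
by rewrite probability_setC// PG subee.
Qed.

(** Processes start at 0 only almost surely, so identities between their events are available only
    on an event [G] of probability one. *)
Lemma probability_eq_on (E F G : set Omega) :
  measurable E -> measurable F -> measurable G -> P G = 1%E ->
  E `&` G = F `&` G -> P E = P F.
Proof.
by move=> mE mF mG PG EF; rewrite -(probability_setI1 mE mG PG) EF probability_setI1.
Qed.

Lemma ae_probability1 (E : set Omega) : measurable E ->
  {ae P, forall w, E w} -> P E = 1%E.
Proof.
move=> mE /negligibleP; rewrite (_ : [set w | _] = E)//.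
move=> /(_ (measurableC mE)) h.
have : (1 - P E = 0)%E by rewrite -probability_setC.
have : P E \is a fin_num by exact: fin_num_measure.
by case: (P E) => //= r _ /eqP; rewrite -EFinB eqe subr_eq0 => /eqP <-.
Qed.

Variable A : nat -> set Omega.
Hypothesis mA : forall k, measurable (A k).
Hypothesis tA : trivIset setT A.
Hypothesis PA : P (\bigcup_k A k) = 1%E.

(** The cells cover only almost surely, which suits the increments of a process valued in the
    naturals: they may be negative on a null event. *)
Lemma probability_as_partition (E : set Omega) : measurable E ->
  P E = (\sum_(k <oo) P (E `&` A k))%E.
Proof.
move=> mE; have mU : measurable (\bigcup_k A k) by exact: bigcupT_measurable.
rewrite -(probability_setI1 mE mU PA) setI_bigcupr measure_semi_bigcup//.
- by move=> i; exact: measurableI.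
- exact: trivIset_setIl.
- by apply: bigcupT_measurable => i; exact: measurableI.
Qed.

Lemma ge0_integral_as_partition (g : Omega -> \bar R) (E : set Omega) :
  measurable E -> measurable_fun setT g -> (forall w, (0 <= g w)%E) ->
  (\int[P]_(w in E) g w = \sum_(k <oo) \int[P]_(w in E `&` A k) g w)%E.
Proof.
move=> mE mg g0; have mU : measurable (\bigcup_k A k) by exact: bigcupT_measurable.
have PN : P (~` \bigcup_k A k) = 0%E by rewrite probability_setC// PA subee.
rewrite (@ge0_negligible_integral _ _ _ P E (~` \bigcup_k A k))//; last 2 first.
- exact: measurableC.
- exact: measurable_funTS.
rewrite setDE setCK setI_bigcupr ge0_integral_bigcup//.
- by move=> i; exact: measurableI.
- exact: measurable_funTS.
- exact: trivIset_setIl.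
Qed.

End almost_sure_partition.

Lemma bigcap_ltnSr (T : Type) (n : nat) (F : nat -> set T) :
  \bigcap_(i in [set i | (i < n.+1)%N]) F i =
  \bigcap_(i in [set i | (i < n)%N]) F i `&` F n.
Proof. by rewrite !bigcap_mkord big_ord_recr. Qed.

Lemma bigcap_ltn0 (T : Type) (F : nat -> set T) :
  \bigcap_(i in [set i | (i < 0)%N]) F i = setT.
Proof. by rewrite bigcap_mkord big_ord0. Qed.

Lemma bigcap_ltnSl (T : Type) (n : nat) (F : nat -> set T) :
  \bigcap_(i in [set i | (i < n.+1)%N]) F i =
  F 0%N `&` \bigcap_(i in [set i | (i < n)%N]) F i.+1.
Proof. by rewrite !bigcap_mkord big_ord_recl. Qed.

Lemma sigma_algebra_bigcap_ltn (T : Type) (G : set (set T)) (F : nat -> set T)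
    (n : nat) : sigma_algebra setT G -> (forall i, (i < n)%N -> G (F i)) ->
  G (\bigcap_(i in [set i | (i < n)%N]) F i).
Proof.
move=> sG; have [GT _ _ GI] := (sigma_algebraP (fun X _ => @subsetT _ X)).1 sG.
elim: n => [|n IH] GF; first by rewrite bigcap_ltn0.
by rewrite bigcap_ltnSr; apply: GI; [apply: IH => i /ltnW /GF|exact: GF].
Qed.

Section nat_process.
Variables (R : realType) (Omega : Type) (N : R -> Omega -> nat).

Lemma nat_fiberE (t : R) (k : nat) :
  [set w | N t w = k] = real_process N t @^-1` [set k%:R : R].
Proof.
apply/seteqP; split => w /=; rewrite /real_process; first by move=> ->.
by move=> /eqP; rewrite eqr_nat => /eqP.
Qed.

Lemma process_sigma_algebra_preimage (t : R) (B : set R) : 0 <= t ->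
  measurable B ->
  process_sigma_algebra (real_process N) (real_process N t @^-1` B).
Proof.
move=> t0 mB; apply: sub_sigma_algebra; exists t => //=.
by exists B => //; rewrite setTI.
Qed.

Lemma process_sigma_algebra_fiber (t : R) (k : nat) : 0 <= t ->
  process_sigma_algebra (real_process N) [set w | N t w = k].
Proof. by move=> t0; rewrite nat_fiberE; exact: process_sigma_algebra_preimage. Qed.

(** There are countably many pairs of values: the event is the union, over i - j in [B], of the
    events where the process is i at [t] and j at [s]. This brings increments within the scope of
    [independent_processes]. *)
Lemma process_sigma_algebra_increment (s t : R) (B : set R) : 0 <= s -> 0 <= t ->
  process_sigma_algebra (real_process N)
    (increment (real_process N) s t @^-1` B).
Proof.
move=> s0 t0.
have sG : sigma_algebra setT (process_sigma_algebra (real_process N)).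
  exact: smallest_sigma_algebra.
have [G0 _ GU] := sG.
have [GT _ _ GI] := (sigma_algebraP (fun X _ => @subsetT _ X)).1 sG.
rewrite (_ : _ @^-1` B = \bigcup_i \bigcup_j
    if `[< B (i%:R - j%:R) >] then [set w | N t w = i] `&` [set w | N s w = j]
    else set0).
  apply: (GU) => i; apply: (GU) => j; case: ifP => // _.
  by apply: GI; exact: process_sigma_algebra_fiber.
apply/seteqP; split => w /=.
  by move=> Bw; exists (N t w) => //; exists (N s w) => //; case: asboolP.
by case=> i _ [j _]; case: asboolP => // Bij [/= ti sj]; rewrite /increment /real_process ti sj.
Qed.

End nat_process.

Lemma expectation_nat (d : measure_display) (Omega : measurableType d)
    (R : realType) (P : probability Omega R) (X : Omega -> nat) (f : nat -> R) :
  (forall k, measurable [set w | X w = k]) -> (forall k, 0 <= f k) ->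
  ('E_P[fun w => f (X w)] = \sum_(k <oo) (f k)%:E * P [set w | X w = k])%E.
Proof.
move=> mX f0.
have tX : trivIset setT (fun k => [set w | X w = k]).
  by apply/trivIsetP => i j _ _ /eqP ij; apply/seteqP; split => // w /= [->].
have UX : \bigcup_k [set w | X w = k] = setT.
  by apply/seteqP; split => // w _; exists (X w).
have mf : measurable_fun setT (fun w => (f (X w))%:E).
  apply/measurable_EFinP => _ B mB; rewrite setTI.
  rewrite (_ : _ @^-1` B = \bigcup_k
      if `[< B (f k) >] then [set w | X w = k] else set0).
    by apply: bigcupT_measurable => k; case: ifP.
  apply/seteqP; split => w /=; first by move=> Bw; exists (X w) => //; case: asboolP.
  by case=> k _; case: asboolP => // Bk /= ->.
rewrite unlock (@ge0_integral_as_partition _ _ _ P _ mX tX)//; last 2 first.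
- by rewrite UX probability_setT.
- by move=> w; rewrite lee_fin.
apply: eq_eseriesr => k _; rewrite setTI.
transitivity (\int[P]_(w in [set w | X w = k]) (cst (f k)%:E) w)%E.
  by apply: eq_integral => w; rewrite inE/= => ->.
exact: integral_cst.
Qed.

Section nat_levy_process.
Variables (d : measure_display) (Omega : measurableType d) (R : realType).
Variables (P : probability Omega R) (N : R -> Omega -> nat).
Hypothesis levyN : levy_process P (real_process N).
Local Notation X := (real_process N).

Lemma measurable_levy_preimage (t : R) (B : set R) : 0 <= t -> measurable B ->
  measurable (X t @^-1` B).
Proof.
move=> t0 mB; have [mX _ _ _] := levyN.
by rewrite -[_ @^-1` _]setTI; exact: mX.
Qed.

Lemma measurable_levy_fiber (t : R) (k : nat) : 0 <= t ->
  measurable [set w | N t w = k].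
Proof. by move=> t0; rewrite nat_fiberE; exact: measurable_levy_preimage. Qed.

Lemma measurable_levy_increment (s t : R) (B : set R) : 0 <= s -> 0 <= t ->
  measurable B -> measurable (increment X s t @^-1` B).
Proof.
move=> s0 t0 mB; have [mX _ _ _] := levyN.
rewrite -[_ @^-1` _]setTI; apply: (measurable_funB (mX _ t0) (mX _ s0)) => //.
Qed.

Lemma levy0 : P [set w | N 0 w = 0%N] = 1%E.
Proof.
have [_ + _ _] := levyN => h; apply: ae_probability1; first exact: measurable_levy_fiber.
apply: filterS h => w /=.
by rewrite /real_process => /eqP; rewrite pnatr_eq0 => /eqP.
Qed.

Lemma levy_increment0 (t : R) (B : set R) : 0 <= t -> measurable B ->
  P (increment X 0 t @^-1` B) = P (X t @^-1` B).
Proof.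
move=> t0 mB; apply: (@probability_eq_on _ _ _ P _ _ _ _ _ _ levy0).
- exact: measurable_levy_increment.
- exact: measurable_levy_preimage.
- exact: measurable_levy_fiber.
- apply/seteqP; split => w /= [Bw w0]; split => //; move: Bw;
    by rewrite /increment /real_process w0 subr0.
Qed.

Lemma levy_increment (s t : R) (B : set R) : 0 <= s -> 0 <= t -> measurable B ->
  P (increment X s (s + t) @^-1` B) = P (X t @^-1` B).
Proof.
by move=> s0 t0 mB; have [_ _ _ ->//] := levyN; exact: levy_increment0.
Qed.

Lemma levy_markov (s t : R) (B C : set R) : 0 <= s -> 0 <= t ->
  measurable B -> measurable C ->
  P (X s @^-1` B `&` increment X s (s + t) @^-1` C) =
  (P (X s @^-1` B) * P (X t @^-1` C))%E.
Proof.
move=> s0 t0 mB mC; have [_ _ indN _] := levyN.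
(* The grid 0, s, s + t is continued as a constant, since [independent_increments] takes a whole
   monotone sequence. The first increment is X s wherever X 0 = 0. *)
pose u (i : nat) : R := if i is i'.+1 then if i' is 0 then s else s + t else 0.
pose D (i : nat) := if i is 0 then B else C.
have hu i : u i <= u i.+1 by case: i => [|[|i]] //=; rewrite lerDl.
have mD i : measurable (D i) by case: i.
have := indN 2 u D (lexx _) hu mD.
rewrite !bigcap_ltnSr bigcap_ltn0 setTI big_ord_recr big_ord1 /=.
rewrite levy_increment0// levy_increment// => <-.
apply: (@probability_eq_on _ _ _ P _ _ _ _ _ _ levy0).
- by apply: measurableI; [exact: measurable_levy_preimage|
    apply: measurable_levy_increment => //; exact: addr_ge0].
- by apply: measurableI; apply: measurable_levy_increment => //; exact: addr_ge0.
- exact: measurable_levy_fiber.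
- apply/seteqP; split => w /= [[Bw Cw] w0]; split => //; split => //;
    by move: Bw; rewrite /increment /real_process w0 subr0.
Qed.

Lemma levy_increment_trivIset (s t : R) :
  trivIset setT (fun k : nat => increment X s t @^-1` [set k%:R]).
Proof.
apply/trivIsetP => i j _ _ ij; apply/seteqP; split => // w /= [-> /eqP].
by rewrite eqr_nat (negPf ij).
Qed.

(** Monotone paths are not assumed; by stationarity the increment has the law of X (t - s), which
    takes values in the naturals. *)
Lemma levy_increment_nat (s t : R) : 0 <= s -> s <= t ->
  P (\bigcup_k (increment X s t @^-1` [set k%:R])) = 1%E.
Proof.
move=> s0 st; have t0 : 0 <= t - s by rewrite subr_ge0.
rewrite -preimage_bigcup -{1}[t](subrK s) addrC levy_increment//; last first.
  by apply: bigcupT_measurable => k; exact: measurable_set1.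
rewrite (_ : _ @^-1` _ = setT) ?probability_setT//.
by apply/seteqP; split => // w _; exists (N (t - s) w).
Qed.

Lemma levy_convolution (s t : R) (n : nat) : 0 <= s -> 0 <= t ->
  P [set w | N (s + t) w = n] =
  (\sum_(j < n.+1) P [set w | N s w = j] * P [set w | N t w = (n - j)%N])%E.
Proof.
move=> s0 t0.
rewrite (@probability_as_partition _ _ _ P (fun k => [set w | N s w = k])).
- rewrite (@nneseries_split _ _ 0 n.+1)// add0n big_mkord.
  rewrite [X in (_ + X)%E](_ : _ = 0%E) ?adde0.
    apply: eq_bigr => j _; have jn : (j <= n)%N by rewrite -ltnS.
    rewrite !nat_fiberE.
    rewrite -levy_markov//; congr (P _).
    rewrite setIC; apply/seteqP; split => w /=; rewrite /increment /real_process.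
      by move=> [-> ->]; split => //; rewrite natrB.
    by move=> [->]; rewrite natrB// => /addIr ->.
  (* For k > n the increment would be the negative real n - k, which X t cannot equal. *)
  apply: eseries0 => k nk _.
  rewrite (_ : _ `&` _ = X s @^-1` [set k%:R] `&`
      increment X s (s + t) @^-1` [set n%:R - k%:R]).
    rewrite levy_markov// (_ : X t @^-1` _ = set0) ?measure0 ?mule0//.
    apply/seteqP; split => // w /= /eqP; rewrite /real_process -subr_eq0 opprB addrA -natrD.
    by rewrite subr_eq0 eqr_nat => /eqP h; move: nk; rewrite -h ltnNge leq_addl.
  rewrite setIC nat_fiberE nat_fiberE.
  by apply/seteqP; split => w /=; rewrite /increment => -[->]; [move=> ->|move=> /addIr ->].
- by move=> k; exact: measurable_levy_fiber.
- by apply/trivIsetP => i j _ _ /eqP ij; apply/seteqP; split => // w /= [->].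
- rewrite (_ : \bigcup_k _ = setT) ?probability_setT//.
  by apply/seteqP; split => // w _; exists (N s w).
- by apply: measurable_levy_fiber; exact: addr_ge0.
Qed.

End nat_levy_process.

(** * Laplace transforms of the marginals of a process valued in the naturals *)

Section levy_laplace.
Variables (d : measure_display) (Omega : measurableType d) (R : realType).
Variables (P : probability Omega R) (N : R -> Omega -> nat).
Hypothesis levyN : levy_process P (real_process N).
Local Notation X := (real_process N).
Variable lambda : R.

Lemma laplaceE (t : R) : 0 <= t ->
  ('E_P[fun w => expR (- (lambda * X t w))] =
   \sum_(k <oo) (expR (- (lambda * k%:R)))%:E * P [set w | N t w = k])%E.
Proof.
move=> t0; rewrite -(@expectation_nat _ _ _ P (N t) (fun k => expR (- (lambda * k%:R))))//.
by move=> k; exact: (measurable_levy_fiber levyN).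
Qed.

Hypothesis lambda0 : 0 <= lambda.

Lemma laplace_itv (t : R) : 0 <= t ->
  (0 <= 'E_P[fun w => expR (- (lambda * X t w))] <= 1)%E.
Proof.
move=> t0; apply/andP; split; first by apply: expectation_ge0 => w; exact: expR_ge0.
rewrite -(expectation_cst P 1); apply: expectation_le => //.
- have [mX _ _ _] := levyN; apply: measurableT_comp => //; apply: measurableT_comp => //.
  by apply: measurable_funM => //; exact: mX.
- apply: aeW => w; rewrite /= expR_le1 oppr_le0.
  by rewrite mulr_ge0// /real_process.
Qed.

(** Cut the space by the value j of X s and the value k of the next increment: the integrand is
    constant on each cell, and [levy_markov] factors the probability of the cell. *)
Lemma laplaceD (s t : R) : 0 <= s -> 0 <= t ->
  ('E_P[fun w => expR (- (lambda * X (s + t) w))] =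
   'E_P[fun w => expR (- (lambda * X s w))] *
   'E_P[fun w => expR (- (lambda * X t w))])%E.
Proof.
move=> s0 t0; have st0 : 0 <= s + t by rewrite addr_ge0.
(* Finiteness is what allows the factor to move inside the extended-real series. *)
have [q qE] : exists q : R, ('E_P[fun w => expR (- (lambda * X t w))] = q%:E)%E.
  have /andP[] := laplace_itv t0.
  by case: ('E_P[_])%E => // r _ _; exists r.
rewrite qE muleC (laplaceE s0) -nneseriesZl; last first.
  by move=> k _; rewrite mule_ge0// lee_fin expR_ge0.
rewrite unlock.
have mg : measurable_fun setT (fun w => (expR (- (lambda * X (s + t) w)))%:E).
  have [mX _ _ _] := levyN; apply/measurable_EFinP.
  apply: measurableT_comp => //; apply: measurableT_comp => //.
  by apply: measurable_funM => //; exact: mX.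
have mF k : measurable [set w | N s w = k] by exact: (measurable_levy_fiber levyN).
have g0 w : (0 <= (expR (- (lambda * X (s + t) w)))%:E)%E by rewrite lee_fin expR_ge0.
rewrite (@ge0_integral_as_partition _ _ _ P (fun k => [set w | N s w = k]))//; last 2 first.
- by apply/trivIsetP => i j _ _ /eqP ij; apply/seteqP; split => // w /= [->].
- rewrite (_ : \bigcup_k _ = setT) ?probability_setT//.
  by apply/seteqP; split => // w _; exists (N s w).
apply: eq_eseriesr => j _; rewrite setTI.
have mD k : measurable (increment X s (s + t) @^-1` [set k%:R]).
  by apply: (measurable_levy_increment levyN) => //; exact: measurable_set1.
rewrite (@ge0_integral_as_partition _ _ _ P
  (fun k => increment X s (s + t) @^-1` [set k%:R]))//; last 2 first.
- exact: levy_increment_trivIset.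
- by apply: (levy_increment_nat levyN) => //; rewrite lerDl.
rewrite -qE (laplaceE t0) muleC.
have [p pE] : exists p : R, P [set w | N s w = j] = p%:E.
  exists (fine (P [set w | N s w = j])); rewrite fineK//.
  exact: fin_num_measure.
rewrite pE -EFinM -nneseriesZl; last first.
  by move=> k _; rewrite mule_ge0// lee_fin expR_ge0.
apply: eq_eseriesr => k _.
transitivity (\int[P]_(w in [set w | N s w = j] `&`
   increment X s (s + t) @^-1` [set k%:R])
   (cst (expR (- (lambda * (j + k)%:R)))%:E) w)%E.
  apply: eq_integral => w; rewrite inE/= => -[sj].
  rewrite /increment /real_process sj => /eqP.
  by rewrite subr_eq => /eqP ->; rewrite natrD addrC.
have mk := levy_markov levyN s0 t0 (measurable_set1 j%:R) (measurable_set1 k%:R).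
rewrite -!nat_fiberE pE in mk.
rewrite integral_cst; last exact: measurableI.
transitivity ((expR (- (lambda * (j + k)%:R)))%:E * (p%:E * P [set w | N t w = k]))%E.
  by congr (_ * _)%E; exact: mk.
rewrite natrD mulrDr opprD expRD !EFinM !muleA; congr (_ * _)%E.
by rewrite -!muleA; congr (_ * _)%E; rewrite muleC.
Qed.

Lemma levy_laplace (t : R) (p : R) : 0 <= t -> 0 < p ->
  ('E_P[fun w => expR (- (lambda * X 1%R w))] = p%:E)%E ->
  ('E_P[fun w => expR (- (lambda * X t w))] = (expR (t * ln p))%:E)%E.
Proof.
move=> t0 p0 E1.
pose phi t := fine ('E_P[fun w => expR (- (lambda * X t w))%R])%E.
have phiE u : 0 <= u -> ('E_P[fun w => expR (- (lambda * X u w))] = (phi u)%:E)%E.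
  by move=> u0; rewrite /phi; have /andP[] := laplace_itv u0; case: ('E_P[_])%E.
have -> : p = phi 1 by rewrite /phi E1.
rewrite phiE//; congr _%:E; apply: multiplicative_expR => //.
- move=> s u s0 u0; apply: EFin_inj.
  by rewrite EFinM -!phiE// ?addr_ge0// laplaceD.
- by move=> u u0; have := laplace_itv u0; rewrite phiE// !lee_fin.
- by rewrite /phi E1.
Qed.

End levy_laplace.

(** * Subordination *)

Section subordination.
Variables (d : measure_display) (Omega : measurableType d) (R : realType).
Variables (P : probability Omega R) (L T : R -> Omega -> nat).
Hypothesis levyL : levy_process P (real_process L).
Hypothesis levyT : levy_process P (real_process T).
Hypothesis indLT : independent_processes P (real_process L) (real_process T).
Local Notation XL := (real_process L).
Local Notation XT := (real_process T).
Let Z (t : R) (w : Omega) : nat := L (T t w)%:R w.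
Local Notation XZ := (real_process Z).

Lemma subordinated_joint (t : R) (m : nat) (B : set R) : 0 <= t -> measurable B ->
  P ([set w | T t w = m] `&` XL m%:R @^-1` B) =
  (P [set w | T t w = m] * P (XL m%:R @^-1` B))%E.
Proof.
move=> t0 mB; rewrite setIC indLT; first exact: muleC.
- exact: process_sigma_algebra_preimage.
- exact: process_sigma_algebra_fiber.
Qed.

(** [L] is measurable at each fixed time, so the random time T t is resolved into its countably many
    values. *)
Lemma measurable_subordinated_preimage (t : R) (B : set R) : 0 <= t ->
  measurable B -> measurable (XZ t @^-1` B).
Proof.
move=> t0 mB; rewrite (_ : _ @^-1` B =
    \bigcup_m ([set w | T t w = m] `&` XL m%:R @^-1` B)).
  apply: bigcupT_measurable => m; apply: measurableI.
    exact: (measurable_levy_fiber levyT).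
  exact: (measurable_levy_preimage levyL).
apply/seteqP; split => w /=; first by move=> Bw; exists (T t w).
by move=> [m _ [/= <-]].
Qed.

Lemma measurable_subordinated (t : R) : 0 <= t -> measurable_fun setT (XZ t).
Proof.
by move=> t0 _ B mB; rewrite setTI; exact: measurable_subordinated_preimage.
Qed.

Lemma measurable_subordinated_increment (s t : R) (B : set R) : 0 <= s -> 0 <= t ->
  measurable B -> measurable (increment XZ s t @^-1` B).
Proof.
move=> s0 t0 mB; rewrite -[_ @^-1` _]setTI.
by apply: (measurable_funB (measurable_subordinated t0) (measurable_subordinated s0)).
Qed.

Section increments.
Variables (u : nat -> R) (B : nat -> set R) (n : nat).
Hypothesis u0 : u 0%N = 0.
Hypothesis u_le : forall i, u i <= u i.+1.
Hypothesis mB : forall i, measurable (B i).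

Let Tinc (i e : nat) := increment XT (u i) (u i.+1) @^-1` [set e%:R].
Let Zinc (i : nat) := increment XZ (u i) (u i.+1) @^-1` B i.
(** By independence and stationarity this is the probability that [T] jumps by [e] over the i-th
    interval while the increment of [Z] lies in [B i]; the position of [L] at the start of the
    interval has dropped out. *)
Let joint (i e : nat) := (P (Tinc i e) * P (XL e%:R @^-1` B i))%E.
Let marginal (i : nat) := (\sum_(e <oo) joint i e)%E.

Let u_ge0 i : 0 <= u i.
Proof. by elim: i => [|i IH]; rewrite ?u0//; exact: le_trans IH _. Qed.

Let mTinc i e : measurable (Tinc i e).
Proof. by apply: (measurable_levy_increment levyT) => //; exact: measurable_set1. Qed.

Let mZinc i : measurable (Zinc i).
Proof. exact: measurable_subordinated_increment. Qed.

Let mcap (F : nat -> set Omega) k : (forall i, measurable (F i)) ->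
  measurable (\bigcap_(i in [set i | (i < k)%N]) F i).
Proof. by move=> mF; apply: bigcap_measurableType => i _. Qed.

Let joint_ge0 i e : (0 <= joint i e)%E.
Proof. by rewrite mule_ge0. Qed.

(* As u 0 = 0 and T 0 = 0 almost surely, fixing the jumps of T fixes its values,
   and the increments of Z become increments of L between deterministic times. *)
Lemma joint_increments (delta : nat -> nat) :
  P (\bigcap_(i in [set i | (i < n)%N]) Zinc i `&`
     \bigcap_(i in [set i | (i < n)%N]) Tinc i (delta i)) =
  (\prod_(i < n) joint i (delta i))%E.
Proof.
(* [S i] is the value of [T] at time [u i] once the jumps are [delta]. *)
pose S i : R := (\sum_(0 <= j < i) delta j)%:R.
have SS i : S i.+1 = S i + (delta i)%:R by rewrite /S big_nat_recr//= natrD.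
have S0 i : 0 <= S i by [].
pose Linc i := increment XL (S i) (S i.+1) @^-1` B i.
have mLinc i : measurable (Linc i) by exact: (measurable_levy_increment levyL).
transitivity (P (\bigcap_(i in [set i | (i < n)%N]) Linc i `&`
     \bigcap_(i in [set i | (i < n)%N]) Tinc i (delta i))).
  apply: (@probability_eq_on _ _ _ P _ _ [set w | T 0 w = 0%N]).
  - by apply: measurableI; exact: mcap.
  - by apply: measurableI; exact: mcap.
  - exact: (measurable_levy_fiber levyT).
  - exact: (levy0 levyT).
  have TS w : T 0 w = 0%N -> (forall i, (i < n)%N -> Tinc i (delta i) w) ->
      forall i, (i <= n)%N -> XT (u i) w = S i.
    move=> w0 Tw; elim=> [_|i IH i_n].
      by rewrite /real_process u0 w0 /S big_geq.
    have := Tw i i_n; rewrite /Tinc /= /increment => /eqP.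
    by rewrite subr_eq IH ?(ltnW i_n)// => /eqP ->; rewrite SS addrC.
  have ZL w : T 0 w = 0%N -> (forall i, (i < n)%N -> Tinc i (delta i) w) ->
      forall i, (i < n)%N -> Zinc i w = Linc i w.
    move=> w0 Tw i i_n; rewrite /Zinc /Linc /= /increment.
    have h j : (j <= n)%N -> XZ (u j) w = XL (S j) w.
      by move=> jn; rewrite -(TS w w0 Tw j jn).
    by rewrite !h// ltnW.
  apply/seteqP; split => w [[Zw Tw] w0]; split => //; split => // i i_n.
    by rewrite -(ZL w w0 Tw i i_n); exact: Zw.
  by rewrite (ZL w w0 Tw i i_n); exact: Zw.
have [_ _ indL _] := levyL; have [_ _ indT _] := levyT.
have sG (X : R -> Omega -> R) : sigma_algebra setT (process_sigma_algebra X).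
  exact: smallest_sigma_algebra.
(* Independence of the two processes separates [L] from [T]; each intersection then factors over the
   intervals, and stationarity of [L] removes the starting points [S i]. *)
rewrite indLT; last 2 first.
- apply: sigma_algebra_bigcap_ltn => // i _.
  exact: process_sigma_algebra_increment.
- apply: sigma_algebra_bigcap_ltn => // i _.
  exact: process_sigma_algebra_increment.
rewrite (indL n S B)//; last by move=> i; rewrite SS lerDl.
rewrite (indT n u (fun i => [set (delta i)%:R]))//.
rewrite muleC -big_split /=; apply: eq_bigr => i _; congr (_ * _)%E.
by rewrite SS (levy_increment levyL).
Qed.

Let Tinc_trivIset i : trivIset setT (Tinc i).
Proof. exact: levy_increment_trivIset. Qed.

Let Tinc_cover i : P (\bigcup_e Tinc i e) = 1%E.
Proof. exact: (levy_increment_nat levyT). Qed.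

Let marginal_ge0 i : (0 <= marginal i)%E.
Proof. exact: nneseries_ge0. Qed.

Let marginal_fin i : marginal i \is a fin_num.
Proof.
rewrite ge0_fin_numE//; apply: (@le_lt_trans _ _ 1%E); last exact: ltry.
rewrite -(probability_setT P).
rewrite (probability_as_partition (@mTinc i) (@Tinc_trivIset i) (Tinc_cover i))//.
apply: lee_nneseries => // e _; rewrite setTI /joint.
by rewrite -[leRHS]mule1 lee_wpmul2l// probability_le1//; exact: (measurable_levy_preimage levyL).
Qed.

(* The jumps of T are summed out one at a time, the last one first: once the first
   k jumps are fixed, the position of L at the start of the k-th interval is
   known. *)
Lemma joint_marginal_increments (delta : nat -> nat) (k : nat) : (k <= n)%N ->
  P (\bigcap_(i in [set i | (i < n)%N]) Zinc i `&`
     \bigcap_(i in [set i | (i < k)%N]) Tinc i (delta i)) =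
  (\prod_(i < n) if (i < k)%N then joint i (delta i) else marginal i)%E.
Proof.
(* Induction on the number j = n - k of jumps already summed out; for j = 0 all jumps are fixed. *)
move=> kn; rewrite -(subKn kn); move: (n - k)%N (leq_subr k n) => {k kn} j.
elim: j delta => [|j IH] delta jn.
  rewrite subn0 joint_increments; apply: eq_bigr => i _.
  by rewrite ltn_ord.
set k := (n - j.+1)%N.
have kS : (n - j = k.+1)%N by rewrite /k subnSK.
have kn : (k < n)%N by rewrite -kS leq_subr.
rewrite (probability_as_partition (@mTinc k) (@Tinc_trivIset k) (Tinc_cover k)); last first.
  by apply: measurableI; exact: mcap.
(* The jump over the k-th interval is fixed to [e], so that the induction hypothesis applies with k
   + 1 fixed jumps. *)
pose upd e i := if i == k then e else delta i.
transitivity (\sum_(e <oo) (\prod_(i < n | i != Ordinal kn)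
    (if (i < k)%N then joint i (delta i) else marginal i)) * joint k e)%E.
  apply: eq_eseriesr => e _.
  transitivity (P (\bigcap_(i in [set i | (i < n)%N]) Zinc i `&`
      \bigcap_(i in [set i | (i < k.+1)%N]) Tinc i (upd e i))).
    rewrite bigcap_ltnSr setIA /upd eqxx; congr (P (_ `&` _ `&` _)).
    by apply: eq_bigcapr => i /= ik; rewrite ltn_eqF.
  have := IH (upd e) (ltnW jn); rewrite kS => ->.
  rewrite (bigD1 (Ordinal kn)) //= muleC ltnSn /upd eqxx; congr (_ * _)%E.
  apply: eq_bigr => i ik; have {}ik : (i : nat) != k by [].
  by rewrite ltnS leq_eqVlt (negPf ik).
set c := (\prod_(_ < n | _) _)%E.
have [r rE] : exists r, c = r%:E.
  exists (fine c); rewrite fineK// /c.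
  apply: (big_ind (fun x => x \is a fin_num)) => //; first by move=> x y; exact: fin_numM.
  move=> i _; case: ifP => // _; apply: fin_numM; apply: fin_num_measure => //.
  exact: (measurable_levy_preimage levyL).
rewrite rE nneseriesZl// -rE /c [RHS](bigD1 (Ordinal kn))//= ltnn.
by rewrite muleC.
Qed.

Lemma subordinated_increments :
  P (\bigcap_(i in [set i | (i < n)%N]) Zinc i) = (\prod_(i < n) marginal i)%E.
Proof.
have := joint_marginal_increments (fun=> 0%N) (leq0n n).
by rewrite bigcap_ltn0 setIT => ->.
Qed.

End increments.

(** This is the factor of an initial interval on which nothing is asked of [Z]. It extends
    [subordinated_increments], whose grids start at 0, to arbitrary starting times. *)
Lemma sum_joint_setT (s t : R) : 0 <= s -> s <= t ->
  (\sum_(e <oo) P (increment XT s t @^-1` [set e%:R]) * P (XL e%:R @^-1` setT) = 1)%E.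
Proof.
move=> s0 st; have t0 := le_trans s0 st.
rewrite -(probability_setT P).
rewrite [RHS](@probability_as_partition _ _ _ P
  (fun e => increment XT s t @^-1` [set e%:R]))//.
- by apply: eq_eseriesr => e _; rewrite preimage_setT probability_setT mule1 setTI.
- by move=> e; apply: (measurable_levy_increment levyT) => //; exact: measurable_set1.
- exact: levy_increment_trivIset.
- exact: (levy_increment_nat levyT).
Qed.

Lemma subordinated_increment (s t : R) (B : set R) : 0 <= s -> s <= t ->
  measurable B ->
  P (increment XZ s t @^-1` B) =
  (\sum_(e <oo) P (increment XT s t @^-1` [set e%:R]) * P (XL e%:R @^-1` B))%E.
Proof.
move=> s0 st mB.
pose u (i : nat) : R := if i is i'.+1 then if i' is 0 then s else t else 0.
pose D (i : nat) : set R := if i is 0 then setT else B.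
have hu i : u i <= u i.+1 by case: i => [|[|i]].
have mD i : measurable (D i) by case: i => [|i]; [exact: measurableT|exact: mB].
have := subordinated_increments 2 (erefl (u 0%N)) hu mD.
rewrite !bigcap_ltnSr bigcap_ltn0 setTI big_ord_recr big_ord1 /=.
by rewrite sum_joint_setT// mul1e preimage_setT setTI.
Qed.

Lemma subordinated_levy : levy_process P XZ.
Proof.
split.
- exact: measurable_subordinated.
- have [_ L0 _ _] := levyL; have [_ T0 _ _] := levyT.
  apply: filterS2 L0 T0 => w; rewrite /real_process => L0 /eqP.
  by rewrite pnatr_eq0 /Z => /eqP ->.
- move=> n t B t0 t_le mB.
  (* The grid is extended by the point 0, with target [setT] on the added interval. *)
  pose u (i : nat) : R := if i is i'.+1 then t i' else 0.
  pose D (i : nat) := if i is i'.+1 then B i' else setT.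
  have hu i : u i <= u i.+1 by case: i.
  have mD i : measurable (D i) by case: i => [|i]; [exact: measurableT|exact: mB].
  have := subordinated_increments n.+1 (erefl (u 0%N)) hu mD.
  rewrite bigcap_ltnSl big_ord_recl /= sum_joint_setT// mul1e preimage_setT setTI => ->.
  apply: eq_bigr => i _; rewrite subordinated_increment//.
  by elim: (i : nat) => // j IH; exact: le_trans IH _.
- move=> s t B s0 t0 mB; have [_ _ _ statT] := levyT.
  (* The law of an increment of [Z] involves the interval only through the law of the increment of
     [T]. *)
  rewrite !subordinated_increment ?lerDl//; apply: eq_eseriesr => e _.
  by rewrite statT.
Qed.

Lemma subordinated_law (t : R) (n : nat) : 0 <= t ->
  P [set w | Z t w = n] =
  (\sum_(m <oo) P [set w | T t w = m] * P [set w | L m%:R w = n])%E.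
Proof.
move=> t0; rewrite (@probability_as_partition _ _ _ P (fun m => [set w | T t w = m])).
- apply: eq_eseriesr => m _; rewrite [X in (_ * P X)%E]nat_fiberE.
  rewrite -subordinated_joint// setIC; congr (P _).
  apply/seteqP; split => w /= [tm]; rewrite /Z /real_process tm => h.
    by rewrite h.
  by move: h => /eqP; rewrite eqr_nat => /eqP.
- by move=> m; exact: (measurable_levy_fiber levyT).
- by apply/trivIsetP => i j _ _ /eqP ij; apply/seteqP; split => // w /= [->].
- rewrite (_ : \bigcup_k _ = setT) ?probability_setT//.
  by apply/seteqP; split => // w _; exists (T t w).
- exact: (measurable_levy_fiber subordinated_levy).
Qed.

(** Both sides are double series over the values of T t and of [L]; nonnegativity of the terms
    allows the interchange. *)
Lemma subordinated_laplace (t lambda : R) : 0 <= t ->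
  ('E_P[fun w => expR (- (lambda * XZ t w))] =
   \sum_(m <oo) P [set w | T t w = m] *
     'E_P[fun w => expR (- (lambda * XL m%:R w))])%E.
Proof.
move=> t0; rewrite (laplaceE subordinated_levy)//.
under eq_eseriesr => n _.
  rewrite subordinated_law// -nneseriesZl; last by move=> m _; rewrite mule_ge0.
  over.
rewrite nneseries_interchange; last first.
  by move=> i j; rewrite !mule_ge0// lee_fin expR_ge0.
apply: eq_eseriesr => m _; rewrite (laplaceE levyL)//.
have -> : P [set w | T t w = m] = (fine (P [set w | T t w = m]))%:E.
  by rewrite fineK//; apply: fin_num_measure; exact: (measurable_levy_fiber levyT).
rewrite -nneseriesZl; last by move=> n _; rewrite mule_ge0// lee_fin expR_ge0.
by apply: eq_eseriesr => n _; rewrite muleCA.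
Qed.

End subordination.

(** * The logarithmic process *)

(* The m-fold convolutions of the law of N 1 are read off the powers of a
   truncation of its generating function. *)
Lemma levy_law_coef (d : measure_display) (Omega : measurableType d)
    (R : realType) (P : probability Omega R) (N : R -> Omega -> nat)
    (p : nat -> R) (m n K : nat) :
  levy_process P (real_process N) ->
  (forall k, P [set w | N 1 w = k] = (p k)%:E) -> (n <= K)%N ->
  P [set w | N m%:R w = n] = (((\poly_(k < K.+1) p k) ^+ m)`_n)%:E.
Proof.
move=> levyN law1; elim: m n => [|m IH] n nK.
  have h := levy0 levyN.
  rewrite expr0 coef1; case: n nK => [//|n] _.
  rewrite -(probability_setI1 _ _ h); last 2 first.
  - exact: (measurable_levy_fiber levyN).
  - exact: (measurable_levy_fiber levyN).
  by rewrite (_ : _ `&` _ = set0) ?measure0//; apply/seteqP; split => // w [/= ->].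
rewrite -natr1 (levy_convolution levyN)// exprSr coefM -sumEFin.
apply: eq_bigr => j _; have jn : (j <= n)%N by rewrite -ltnS.
rewrite IH ?(leq_trans jn)// law1 EFinM coef_poly ltnS.
by rewrite (leq_trans (leq_subr _ _) nK).
Qed.

(** The Poisson generating function is used at z = exp (- 1) to identify the rate, and at the
    Laplace transform of L 1 to obtain that of [Z]. *)
Lemma poisson_laplace (d : measure_display) (Omega : measurableType d)
    (R : realType) (P : probability Omega R) (T : R -> Omega -> nat)
    (r t z : R) :
  (forall k, P [set w | T t w = k] =
     (expR (- (r * t)) * (r * t) ^+ k / k`!%:R)%:E) ->
  (\sum_(k <oo) P [set w | T t w = k] * (z ^+ k)%:E =
   (expR (- (r * t * (1 - z))))%:E)%E.
Proof.
move=> law.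
under eq_eseriesr => k _ do rewrite law -EFinM.
apply: cvg_nneseries.
rewrite (_ : (fun _ => _) = (fun M => expR (- (r * t)) *
    \sum_(0 <= k < M) (r * t * z) ^+ k / k`!%:R)).
  rewrite mulrBr mulr1 opprB addrC expRD; apply: cvgMr.
  exact: is_cvg_series_exp_coeff.
apply/funext => M; rewrite mulr_sumr; apply: eq_bigr => k _.
by rewrite !exprMn; ring.
Qed.

(** [poisson_subordinator] provides some rate [r]; comparing Laplace transforms at t = lambda = 1
    identifies it, as 1 - exp (- 1) is nonzero. *)
Lemma poisson_rate (d : measure_display) (Omega : measurableType d)
    (R : realType) (P : probability Omega R) (T : R -> Omega -> nat) (b r : R) :
  levy_process P (real_process T) ->
  bernstein_function P (real_process T) (fun lambda => b * (1 - expR (- lambda))) ->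
  (forall k, P [set w | T 1 w = k] = (expR (- (r * 1)) * (r * 1) ^+ k / k`!%:R)%:E) ->
  r = b.
Proof.
move=> levyT bernT law.
have := bernT 1 1 ler01 ler01; rewrite (laplaceE levyT)//.
under eq_eseriesr => k _.
  rewrite muleC mul1r -[k%:R]mulr1 -mulrN expRM_natl; over.
rewrite (poisson_laplace _ law) => -[/(@expR_inj R)/oppr_inj].
rewrite mulr1 mul1r => /mulIf; apply.
by rewrite subr_eq0 eq_sym lt_eqF// expR_lt1 oppr_lt0.
Qed.

Section logarithmic_law.
Variables (R : realType) (alpha : R).
Hypotheses (alpha0 : 0 < alpha) (alpha1 : alpha < 1).
Local Notation A := (- ln (1 - alpha)).

Let x (lambda : R) : R := alpha * expR (- lambda).
(** The generating function - ln (1 - alpha s) / (A s) of the logarithmic law, at s = exp (-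
    lambda). *)
Let G (lambda : R) : R := - ln (1 - x lambda) / (A * expR (- lambda)).

Lemma log_argument_itv (lambda : R) : 0 <= lambda -> 0 < x lambda < 1.
Proof.
move=> l0; rewrite mulr_gt0 ?expR_gt0//=.
by rewrite (le_lt_trans _ alpha1)// ler_piMr ?expR_le1 ?oppr_le0// ltW.
Qed.

Lemma oppr_ln1B_gt0 (u : R) : 0 < u < 1 -> 0 < - ln (1 - u).
Proof. by move=> /andP[u0 u1]; rewrite oppr_gt0 ln_lt0// subr_gt0 u1 gtrBl. Qed.

Let A0 : 0 < A. Proof. by apply: oppr_ln1B_gt0; rewrite alpha0. Qed.

Lemma log_laplace_gt0 (lambda : R) : 0 <= lambda -> 0 < G lambda.
Proof.
move=> l0; rewrite divr_gt0 ?mulr_gt0 ?expR_gt0//.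
exact/oppr_ln1B_gt0/log_argument_itv.
Qed.

(** The k-th weight carries alpha^(k+1) against exp (- lambda)^k; supplying the missing factor gives
    the logarithmic series at [x lambda], divided by exp (- lambda). *)
Lemma cvg_log_laplace (lambda : R) : 0 <= lambda ->
  (\sum_(0 <= k < M) expR (- (lambda * k%:R)) * (A^-1 * (alpha ^+ k.+1 / k.+1%:R)))
    @[M --> \oo] --> G lambda.
Proof.
move=> l0; have /andP[x0 x1] := log_argument_itv l0.
have e0 := lt0r_neq0 (expR_gt0 (- lambda)).
rewrite (_ : (fun _ => _) = (fun M => (\sum_(0 <= k < M) x lambda ^+ k.+1 / k.+1%:R)
    / (A * expR (- lambda)))).
  by apply: cvgMl; apply: cvg_log_series; rewrite ltW.
apply/funext => M; rewrite mulr_suml; apply: eq_bigr => k _.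
rewrite -mulNr expRM_natr /x exprMn [expR _ ^+ k.+1]exprS.
have k0 : k.+1%:R != 0 :> R by rewrite pnatr_eq0.
move: (k.+1%:R : R) (- ln (1 - alpha)) (lt0r_neq0 A0) k0 => c a a0 c0.
by field; rewrite e0 a0 c0.
Qed.

(** [h] isolates the 0 / 0 form in [G] at infinity, where [x lambda] tends to 0. *)
Let h (lambda : R) : R := x lambda / (- ln (1 - x lambda)).

Let cvg_h : h lambda @[lambda --> +oo] --> (1 : R).
Proof.
apply: (@squeeze_cvgr _ _ _ _ (fun lambda => 1 - x lambda) (cst 1)).
- near=> lambda; apply: ln1B_bounds; apply: log_argument_itv.
  by near: lambda; exact: nbhs_pinfty_ge.
- rewrite -[X in _ --> X]subr0; apply: cvgB; first exact: cvg_cst.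
  rewrite -(mulr0 alpha); apply: cvgMr; exact: cvgr_expR.
- exact: cvg_cst.
Unshelve. all: end_near. Qed.

Let GE (lambda : R) : G lambda = alpha / A * (h lambda)^-1.
Proof.
rewrite /G /h /x invf_div.
move: (expR (- lambda)) (lt0r_neq0 (expR_gt0 (- lambda))) (- ln (1 - alpha))
  (lt0r_neq0 A0) (lt0r_neq0 alpha0) (- ln (1 - alpha * _)) => e e0 a a0 al0 l.
by field; rewrite e0 a0 al0.
Qed.

Lemma cvg_log_laplacey : G lambda @[lambda --> +oo] --> alpha / A.
Proof.
rewrite (_ : G = fun lambda => alpha / A * (h lambda)^-1); last exact/funext.
rewrite [X in _ --> X](_ : _ = alpha / A * 1^-1); last by rewrite invr1 mulr1.
by apply: cvgMr; apply: cvgV => //; exact: oner_neq0.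
Qed.

(** This is 1 + y < exp y at y = - alpha; it makes both limits at infinity, of psi_L and of psi_Z,
    positive. *)
Lemma alpha_lt_opp_ln : alpha < A.
Proof.
rewrite ltrNr -ltr_expR lnK ?posrE ?subr_gt0//.
by apply: expR_gt1Dx; rewrite oppr_eq0 lt0r_neq0.
Qed.

End logarithmic_law.

Theorem theorem3 (d : measure_display) (Omega : measurableType d)
    (R : realType) (P : probability Omega R) (alpha A b : R)
    (L T : R -> Omega -> nat) :
  let psi_L := fun lambda : R =>
    ln (A * expR (- lambda) / (- ln (1 - alpha * expR (- lambda)))) in
  let psi_T := fun lambda : R => b * (1 - expR (- lambda)) in
  let Z := fun (t : R) (w : Omega) => L (T t w)%:R w in
  let psi_Z := fun lambda : R =>
    b * (1 + ln (1 - alpha * expR (- lambda)) / (A * expR (- lambda))) in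
  let Pi_Z := fun n : nat => b * alpha ^+ n.+1 / (A * n.+1%:R) in
  let theta := b - alpha * b / A in
  let c := fun k : nat => k`!%:R / k.+1%:R in
  0 < alpha -> alpha < 1 -> A = - ln (1 - alpha) -> 0 < b ->
  levy_process P (real_process L) ->
  (forall k : nat,
    P [set w | L 1 w = k] = (A^-1 * (alpha ^+ k.+1 / k.+1%:R))%:E) ->
  poisson_subordinator P T ->
  bernstein_function P (real_process T) psi_T ->
  independent_processes P (real_process L) (real_process T) ->
  [/\ bernstein_function P (real_process L) psi_L,
      psi_L lambda @[lambda --> +oo] --> ln (A / alpha),
      0 < ln (A / alpha)
    & psi_T lambda @[lambda --> +oo] --> b] /\
  levy_process P (real_process Z) /\
  [/\ bernstein_function P (real_process Z) psi_Z,
      psi_Z lambda @[lambda --> +oo] --> b * (1 - alpha / A)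
    & 0 < b * (1 - alpha / A)] /\
  levy_measure P Z Pi_Z /\
  (forall (t : R) (n : nat), 0 <= t ->
    P [set w | Z t w = n] =
    (expR (- (theta * t)) * (alpha ^+ n / n`!%:R) *
     \sum_(k < n.+1) (alpha * b * t / A) ^+ k * partial_bell n k c)%:E).
Proof.
move=> psi_L psi_T Z psi_Z Pi_Z theta c alpha0 alpha1 AE b0 levyL law1 poisT bernT indLT.
have A_gt0 : 0 < A by rewrite AE; apply: oppr_ln1B_gt0; rewrite alpha0.
have alphaA : alpha < A by rewrite AE; exact: alpha_lt_opp_ln.
have [[levyT _] [r r0 lawTr]] := poisT.
have rb : r = b by apply: (poisson_rate levyT bernT) => k; exact: lawTr.
have lawT t k : 0 <= t -> P [set w | T t w = k] =
    (expR (- (b * t)) * (b * t) ^+ k / k`!%:R)%:E by rewrite -rb; exact: lawTr.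
have levyZ : levy_process P (real_process Z) by exact: subordinated_levy.
pose G (lambda : R) : R := - ln (1 - alpha * expR (- lambda)) / (A * expR (- lambda)).
have G0 lambda : 0 <= lambda -> 0 < G lambda.
  by rewrite /G AE; exact: log_laplace_gt0.
have GL lambda : 0 <= lambda ->
    ('E_P[fun w => expR (- (lambda * real_process L 1%R w))] = (G lambda)%:E)%E.
  move=> l0; rewrite (laplaceE levyL)//.
  under eq_eseriesr => k _ do rewrite law1 -EFinM.
  by apply: cvg_nneseries; rewrite /G AE; exact: cvg_log_laplace.
have psi_LE lambda : psi_L lambda = ln (G lambda)^-1.
  by rewrite /psi_L /G invf_div.
have psi_ZE lambda : psi_Z lambda = b * (1 - G lambda).
  by rewrite /psi_Z /G mulNr opprK.
have Gy : G lambda @[lambda --> +oo] --> alpha / A.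
  by rewrite /G AE; exact: cvg_log_laplacey.
have bernZ : bernstein_function P (real_process Z) psi_Z.
  move=> t lambda t0 l0; rewrite (subordinated_laplace levyL levyT indLT)//.
  rewrite psi_ZE mulrA [t * b]mulrC -(poisson_laplace (T := T) (P := P))//; last first.
    by move=> k; exact: lawT.
  apply: eq_eseriesr => m _.
  (* At the integer time m the transform of [L] is the m-th power of [G lambda]. *)
  rewrite (levy_laplace levyL l0 _ (G0 _ l0) (GL _ l0))//.
  by rewrite expRM_natl lnK// posrE G0.
split; [split|split; [|split; [split|split]]] => //.
- move=> t lambda t0 l0; rewrite (levy_laplace levyL l0 t0 (G0 _ l0) (GL _ l0)).
  by rewrite psi_LE lnV ?posrE ?G0// mulrN opprK.
- rewrite (_ : psi_L = fun lambda => ln (G lambda)^-1); last exact/funext.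
  rewrite -[A / alpha]invf_div.
  apply: (@continuous_cvg _ _ _ _ _ _ (@ln R)).
    by apply: continuous_ln; rewrite invr_gt0 divr_gt0.
  by apply: cvgV => //; rewrite lt0r_neq0// divr_gt0.
- by rewrite ln_gt0// ltr_pdivlMr// mul1r.
- rewrite [X in _ --> X](_ : _ = b * (1 - 0)); last by rewrite subr0 mulr1.
  apply: cvgMr; apply: cvgB; [exact: cvg_cst|exact: cvgr_expR].
- rewrite (_ : psi_Z = fun lambda => b * (1 - G lambda)); last exact/funext.
  by apply: cvgMr; apply: cvgB => //; exact: cvg_cst.
- by rewrite mulr_gt0// subr_gt0 ltr_pdivrMr// mul1r.
- split; first by move=> n _; rewrite divr_ge0 ?mulr_ge0 ?exprn_ge0// ltW.
  exists psi_Z => // lambda l0.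
  have x01 : 0 <= alpha * expR (- lambda) < 1.
    by have /andP[h ->] := log_argument_itv alpha0 alpha1 l0; rewrite ltW.
  have a01 : 0 <= alpha < 1 by rewrite ltW.
  have e0 := lt0r_neq0 (expR_gt0 (- lambda)).
  have An0 := lt0r_neq0 A_gt0.
  (* The factor 1 - exp (- lambda n) splits the sum into two logarithmic series, at alpha and at
     alpha exp (- lambda); the second is divided by exp (- lambda) because its powers are n + 1. *)
  rewrite (_ : psi_Z lambda = b / A * (- ln (1 - alpha)
      - (expR (- lambda))^-1 * - ln (1 - alpha * expR (- lambda)))); last first.
    by rewrite -AE /psi_Z; field; rewrite An0 e0.
  rewrite (_ : (fun _ => _) = (fun M => b / A *
      (\sum_(0 <= n < M) alpha ^+ n.+1 / n.+1%:R - (expR (- lambda))^-1 *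
       \sum_(0 <= n < M) (alpha * expR (- lambda)) ^+ n.+1 / n.+1%:R))).
    by apply: cvgMr; apply: cvgB; [|apply: cvgMr]; exact: cvg_log_series.
  apply/funext => M.
  (* The term n = 0 can be added since its factor 1 - exp 0 vanishes. *)
  transitivity (\sum_(0 <= n < M) (1 - expR (- (lambda * n%:R))) * Pi_Z n).
    by case: M => [|M]; [rewrite !big_geq|
      rewrite [RHS]big_ltn// mulr0 oppr0 expR0 subrr mul0r add0r].
  rewrite mulr_sumr -sumrB mulr_sumr; apply: eq_bigr => n _.
  rewrite /Pi_Z -mulNr expRM_natr exprMn [expR _ ^+ n.+1]exprS.
  have n0 : n.+1%:R != 0 :> R by rewrite pnatr_eq0.
  move: (n.+1%:R : R) n0 => m m0.
  by field; rewrite e0 An0 m0.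
- move=> t n t0; rewrite (subordinated_law levyL levyT indLT)//.
  pose p k : R := A^-1 * (alpha ^+ k.+1 / k.+1%:R).
  under eq_eseriesr => m _.
    rewrite lawT// (@levy_law_coef _ _ _ P L p m n n)// -EFinM; over.
  apply: (cvg_nneseries (u := fun m => expR (- (b * t)) * (b * t) ^+ m / m`!%:R *
     ((\poly_(k < n.+1) p k) ^+ m)`_n)).
  rewrite [X in _ --> X](_ : _ = expR (- (b * t * (1 - p 0%N))) *
    \sum_(k < n.+1) (b * t) ^+ k / k`!%:R *
      ((\sum_(i < n) p i.+1 *: 'X^(i.+1)) ^+ k)`_n); first exact: cvg_compound_poisson.
  (* As p 0 = alpha / A, the exponent b t (1 - p 0) is theta t. *)
  rewrite -mulrA; congr (_ * _); first by rewrite /theta /p; congr expR; field; rewrite lt0r_neq0.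
  have f0 (m : nat) : m`!%:R != 0 :> R by rewrite pnatr_eq0 -lt0n fact_gt0.
  rewrite mulr_sumr; apply: eq_bigr => k _.
  (* With c j = j! / (j + 1) this makes p j = x j / j!. Its form u v^j c j, with u = alpha / A and v
     = alpha, is the one [partial_bell_scale] expects. *)
  pose x j := alpha / A * alpha ^+ j * c j.
  rewrite (_ : \sum_(i < n) _ = \sum_(i < n) (x i.+1 / i.+1`!%:R) *: 'X^(i.+1)); last first.
    apply: eq_bigr => i _; congr (_ *: _); rewrite /p /x /c [alpha ^+ i.+2]exprS.
    have i0 : i.+2%:R != 0 :> R by rewrite pnatr_eq0.
    move: (i.+2%:R : R) (i.+1`!%:R : R) i0 (f0 i.+1) => u v u0 v0.
    by field; rewrite u0 v0 lt0r_neq0.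
  rewrite coef_expr_partial_bell ?partial_bell_scale -1?ltnS//.
  have -> : (alpha * b * t / A) ^+ k = (b * t) ^+ k * (alpha / A) ^+ k.
    by rewrite -exprMn; congr (_ ^+ _); field; rewrite lt0r_neq0.
  by field; rewrite !f0.
Qed.
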